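(* Let $(X_n)$ be a weakly convergent sequence of real-valued random variables such that $\mathsf E|X_n|<\infty$ for all $n$ (resp. $\mathsf E[X_n^-]<\infty$ for all $n$, resp. $\mathsf E[X_n^+]<\infty$ for all $n$), and let $\mathsf K_{X_n}$ be their integrated quantile functions. Then the following statements are equivalent: (i) The sequence $(|X_n|)$ (resp. $(X_n^-)$, resp. $(X_n^+)$) is uniformly integrable. (ii) The sequence of functions $(\mathsf K_{X_n})$ converges pointwise on $[0,1]$ (resp. $[0,1)$, resp. $(0,1]$) to a continuous function with finite values. (iii) The sequence $(\mathsf K_{X_n})$ converges uniformly to a finite-valued function on $[0,1]$ (resp. on every $[0,\beta]\subseteq[0,1)$, resp. on every $[\alpha,1]\subseteq(0,1]$).
   Context: For a random variable $X$ with distribution function $F_X(x)=\mathsf P(X\le x)$, the integrated distribution function is $\mathsf J_X(x)=\int_0^xF_X(t)\,dt$, $x\in\mathbb R$ (with $\int_a^b:=-\int_b^a$ if $b<a$), and the integrated quantile function is its Fenchel transform $\mathsf K_X(u)=\sup_{x\in\mathbb R}\{xu-\mathsf J_X(x)\}\in\mathbb R\cup\{+\infty\}$, $u\in\mathbb R$. Weak convergence of $(X_n)$ means convergence in distribution to some real-valued random variable (the $X_n$ may live on different probability spaces). $y^+=\max(y,0)$, $y^-=\max(-y,0)$. The ''resp.'' gives three parallel theorems. *)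

(* Defs.v *)
From HB Require Import structures.
From mathcomp Require Import all_boot all_order all_algebra.
From mathcomp Require Import all_classical all_reals all_analysis.

Set Implicit Arguments.
Unset Strict Implicit.
Unset Printing Implicit Defensive.

Import Order.TTheory GRing.Theory Num.Theory.
Import numFieldNormedType.Exports.

Local Open Scope classical_set_scope.
Local Open Scope ring_scope.

(* The second branch is the convention that the integral from a to b is minus
   the integral from b to a when b < a. *)
Definition integrated_cdf (R : realType) (d : measure_display)
    (T : measurableType d) (P : probability T R) (X : {RV P >-> R})
    (x : R) : R :=
  if 0 <= x then \int[lebesgue_measure]_(t in `[0, x]) fine (cdf X t)
  else - \int[lebesgue_measure]_(t in `[x, 0]) fine (cdf X t).

Definition integrated_quantile (R : realType) (d : measure_display)
    (T : measurableType d) (P : probability T R) (X : {RV P >-> R})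
    (u : R) : \bar R :=
  ereal_sup (range (fun x : R => (x * u - integrated_cdf X x)%:E)).

Definition cvg_in_distribution (R : realType) (d : nat -> measure_display)
    (T : forall n, measurableType (d n)) (P : forall n, probability (T n) R)
    (X : forall n, {RV (P n) >-> R}) (d' : measure_display)
    (T' : measurableType d') (P' : probability T' R) (Y : {RV P' >-> R}) :
    Prop :=
  forall x : R, {for x, continuous (cdf Y)} ->
    cdf (X n) x @[n --> \oo] --> cdf Y x.

Definition weakly_convergent (R : realType) (d : nat -> measure_display)
    (T : forall n, measurableType (d n)) (P : forall n, probability (T n) R)
    (X : forall n, {RV (P n) >-> R}) : Prop :=
  exists (d' : measure_display) (T' : measurableType d')
    (P' : probability T' R) (Y : {RV P' >-> R}), cvg_in_distribution X Y.

Definition uniformly_integrable (R : realType) (d : nat -> measure_display)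
    (T : forall n, measurableType (d n)) (P : forall n, probability (T n) R)
    (Z : forall n, T n -> R) : Prop :=
  (fun c : R => ereal_sup (range (fun n : nat =>
     \int[P n]_(w in [set w | (c < `|Z n w|)%R]) (`|Z n w|%R)%:E)))%E
  @ +oo --> 0%E.

(* K may take infinite values, the limit f may not.  The uniform structure of
   \bar R comes from a bounded distance, so it is not the one meant here; the
   inequality below forces K n u to be finite. *)
Definition cvg_uniformly_on (R : realType) (A : set R)
    (K : nat -> R -> \bar R) (f : R -> R) : Prop :=
  forall e : R, 0 < e ->
    \forall n \near \oo, forall u : R, A u -> (`|K n u - (f u)%:E| < e%:E)%E.

(* Main.v *)
Require Import Defs.
From HB Require Import structures.
From mathcomp Require Import all_boot all_order all_algebra.
From mathcomp Require Import all_classical all_reals all_analysis.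
From mathcomp Require Import measurable_realfun ring lra.

(* With J_n, K_n the integrated distribution and quantile functions of X_n,
   E (X_n + c)^- = sup_x (J_n(-c) - J_n(x)) = K_n(0) + J_n(-c), so uniform
   integrability of the X_n^- says that the suprema defining K_n(0) are
   attained up to e on a common [-c, 0].  The substitution X |-> -X turns J(x)
   into x + J(-x) and K(u) into K(1 - u), which gives the same for X_n^+ and
   K_n(1).  Weak convergence yields J_n -> J pointwise, hence uniformly on
   compact sets as the J_n are 1-Lipschitz.
   (i) => (iii): for all u in the interval under consideration, the supremum
   sup_x (x u - J_n(x)) may be restricted to a common compact set up to e: near
   u = 0 and u = 1 by uniform integrability, elsewhere because the slopes of
   the convex function J_n tend to 0 and 1.
   (iii) => (ii): a supremum over |x| <= c is c-Lipschitz in u.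
   (ii) => (i): K_n(u) -> K(u) for 0 < u < 1 in any case.  The continuity of the
   limit f at 0 gives K(u) > f(0) - e for a small u > 0, hence
   -J(x) > f(0) - 2e for some x, and as K_n(0) -> f(0) the supremum defining
   K_n(0) is attained at x up to 4e for n large. *)

Set Implicit Arguments.
Unset Strict Implicit.
Unset Printing Implicit Defensive.

Import Order.TTheory GRing.Theory Num.Theory.
Import numFieldNormedType.Exports.

Local Open Scope classical_set_scope.
Local Open Scope ring_scope.

(** * Integrals of the distribution function *)

Section cdf_integrals.
Context (R : realType) (d : measure_display) (T : measurableType d)
  (P : probability T R) (X : {RV P >-> R}).
Local Notation mu := (@lebesgue_measure R).
Local Notation F := (fun t : R => fine (cdf X t)).
Local Notation J := (integrated_cdf X).

Lemma lebesgue_measure_itvcc_lty (a b : R) : (mu `[a, b] < +oo)%E.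
Proof.
by rewrite lebesgue_measure_itv/=; case: ifP => _; rewrite ?ltry// -EFinB ltry.
Qed.

Lemma EFin_fine_cdf t : (F t)%:E = cdf X t.
Proof. by rewrite fineK// fin_num_measure. Qed.

Lemma fine_cdf_ge0 t : 0 <= F t.
Proof. by rewrite fine_ge0// cdf_ge0. Qed.

Lemma fine_cdf_le1 t : F t <= 1.
Proof. by rewrite -lee_fin EFin_fine_cdf cdf_le1. Qed.

Lemma fine_cdf_nondecreasing : nondecreasing F.
Proof.
by move=> s t st; rewrite -lee_fin !EFin_fine_cdf; exact: cdf_nondecreasing.
Qed.

Lemma fine_cdf_integrable (a b : R) : mu.-integrable `[a, b] (EFin \o F).
Proof.
apply: measurable_bounded_integrable => //.
- exact: lebesgue_measure_itvcc_lty.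
- apply: measurable_funTS.
  exact: nondecreasing_measurable fine_cdf_nondecreasing.
- exists 1; split => // M M1 t _ /=.
  by rewrite ger0_norm ?fine_cdf_ge0// (le_trans (fine_cdf_le1 _))// ltW.
Qed.

Lemma Rintegral_fine_cdf (x y : R) : x <= y ->
  \int[mu]_(t in `[x, y]) F t = J y - J x.
Proof.
have additive a b c : a <= b -> b <= c -> \int[mu]_(t in `[a, c]) F t =
    \int[mu]_(t in `[a, b]) F t + \int[mu]_(t in `[b, c]) F t.
  move=> ab bc; have := @Rintegral_itvB R F (BLeft a) (BRight c) b
    (fine_cdf_integrable a c).
  rewrite !bnd_simp => /(_ ab bc).
  rewrite Rintegral_itv_obnd_cbnd; last first.
    apply: integrableS (fine_cdf_integrable b c) => //.
    exact: subset_itv_oc_cc.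
  by move=> <-; rewrite addrC subrK.
move=> xy; rewrite /integrated_cdf.
case: (leP 0 x) => x0.
  by rewrite (le_trans x0 xy) (additive 0 x y)//; ring.
case: (leP 0 y) => y0; first by rewrite (additive x 0 y) ?(ltW x0)//; ring.
by rewrite (additive x y 0) ?(ltW y0)//; ring.
Qed.

Lemma integral_cdf (x y : R) : x <= y ->
  (\int[mu]_(t in `[x, y]) cdf X t = (J y - J x)%:E)%E.
Proof.
move=> xy; rewrite -(Rintegral_fine_cdf xy) /Rintegral fineK.
  by apply: eq_integral => t _; rewrite EFin_fine_cdf.
by apply: integrable_fin_num => //; exact: fine_cdf_integrable.
Qed.

(** A monotone integrand lies between its values at the two ends. Monotonicity, the Lipschitz bound,
    convexity and the asymptotic slopes of [J] are all read off from these two inequalities. *)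
Lemma integrated_cdf_slope (x y : R) : x <= y ->
  F x * (y - x) <= J y - J x <= F y * (y - x).
Proof.
move=> xy; rewrite -Rintegral_fine_cdf//.
have cst_int c : \int[mu]_(t in `[x, y]) c = c * (y - x).
  rewrite Rintegral_cst//= lebesgue_measure_itv/= lte_fin.
  by case: ltgtP xy => //= -> _; rewrite subrr.
have icst c : mu.-integrable `[x, y] (EFin \o (fun=> c)).
  apply: measurable_bounded_integrable => //.
  - exact: lebesgue_measure_itvcc_lty.
  - exact: bounded_cst.
by rewrite -!cst_int; apply/andP; split; apply: le_Rintegral => //;
  try exact: icst; try exact: fine_cdf_integrable;
  move=> t; rewrite /= in_itv/= => /andP[xt ty]; exact: fine_cdf_nondecreasing.
Qed.

(** The region for Tonelli's theorem: its section at [w] is [[X w, y]], its section at [t <= y] is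
    the event [X <= t]. *)
Lemma measurable_subgraph (y : R) :
  measurable [set p : T * R | X p.1 <= p.2 /\ p.2 <= y].
Proof.
rewrite (_ : [set _ | _] =
    (fun p : T * R => X p.1 <= p.2) @^-1` [set true] `&`
    (fun p : T * R => p.2 <= y) @^-1` [set true]); last first.
  by apply/seteqP; split=> p.
apply: measurableI.
- rewrite -[X in measurable X]setTI; apply: measurable_fun_ler => //.
  exact: measurableT_comp.
- by rewrite -[X in measurable X]setTI; exact: measurable_fun_ler.
Qed.

(** The counterpart for the upper tail, with sections [[y, X w[] and, for [t >= y], the event
    [t < X] measured by [ccdf]. *)
Lemma measurable_supgraph (y : R) :
  measurable [set p : T * R | y <= p.2 /\ p.2 < X p.1].
Proof.
rewrite (_ : [set _ | _] =
    (fun p : T * R => y <= p.2) @^-1` [set true] `&`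
    (fun p : T * R => p.2 < X p.1) @^-1` [set true]); last first.
  by apply/seteqP; split=> p.
apply: measurableI.
- by rewrite -[X in measurable X]setTI; exact: measurable_fun_ler.
- rewrite -[X in measurable X]setTI; apply: measurable_fun_ltr => //.
  exact: measurableT_comp.
Qed.

(** The positive part of [y - X w] is the length of [[X w, y]]; exchanging the order of integration
    gives the claim. *)
Lemma integral_cdfNy (y : R) :
  (\int[P]_w (Num.max (y - X w) 0)%:E = \int[mu]_(t in `]-oo, y]) cdf X t)%E.
Proof.
have mA := measurable_subgraph y; set A := (X in measurable X) in mA.
have := indic_fubini_tonelli P mu mA.
rewrite indic_fubini_tonelli_FE// indic_fubini_tonelli_GE// => fubini.
transitivity (\int[P]_w mu (xsection A w))%E.
  apply: eq_integral => w _; rewrite (_ : xsection A w = `[X w, y]%classic).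
    rewrite lebesgue_measure_itv/= lte_fin; case: ltP => Xy.
      by rewrite -EFinB max_l// subr_ge0 ltW.
    by rewrite max_r// subr_le0.
  by apply/seteqP; split => t; rewrite /xsection/= inE/= in_itv/= => /andP.
rewrite [LHS]fubini [RHS]integral_mkcond; apply: eq_integral => t _ /=.
rewrite patchE; case: ifPn => [|]; rewrite ?inE ?notin_setE/= in_itv/=.
  move=> ty; congr (P _); apply/seteqP; split=> w;
    rewrite /ysection/= inE/= in_itv/=.
  - by case.
  - by [].
move=> ty; rewrite (_ : ysection _ _ = set0) ?measure0//.
by apply/seteqP; split => w; rewrite /ysection/= ?inE//= => -[].
Qed.

Lemma integral_ccdfy (y : R) :
  (\int[P]_w (Num.max (X w - y) 0)%:E = \int[mu]_(t in `[y, +oo[) ccdf X t)%E.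
Proof.
have mA := measurable_supgraph y; set A := (X in measurable X) in mA.
have := indic_fubini_tonelli P mu mA.
rewrite indic_fubini_tonelli_FE// indic_fubini_tonelli_GE// => fubini.
transitivity (\int[P]_w mu (xsection A w))%E.
  apply: eq_integral => w _; rewrite (_ : xsection A w = `[y, X w[%classic).
    rewrite lebesgue_measure_itv/= lte_fin; case: ltP => Xy.
      by rewrite -EFinB max_l// subr_ge0 ltW.
    by rewrite max_r// subr_le0.
  by apply/seteqP; split => t; rewrite /xsection/= inE/= in_itv/= => /andP.
rewrite [LHS]fubini [RHS]integral_mkcond; apply: eq_integral => t _ /=.
rewrite patchE; case: ifPn => [|]; rewrite ?inE ?notin_setE/= in_itv/= andbT.
  move=> ty; congr (P _); apply/seteqP; split=> w;
    rewrite /ysection/= inE/= in_itv/= andbT.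
  - by case.
  - by [].
move=> ty; rewrite (_ : ysection _ _ = set0) ?measure0//.
by apply/seteqP; split => w; rewrite /ysection/= ?inE//= => -[].
Qed.

Lemma integral_cdfNy_ge (x y : R) :
  ((J y - J x)%:E <= \int[P]_w (Num.max (y - X w) 0)%:E)%E.
Proof.
have [xy|yx] := leP x y; last first.
  apply: (@le_trans _ _ 0%E); last first.
    by apply: integral_ge0 => w _; rewrite lee_fin le_max lexx orbT.
  rewrite lee_fin subr_le0 -subr_ge0.
  have /andP[+ _] := integrated_cdf_slope (ltW yx); apply: le_trans.
  by rewrite mulr_ge0 ?fine_cdf_ge0// subr_ge0 ltW.
rewrite -integral_cdf// integral_cdfNy; apply: ge0_subset_integral => //.
- by apply: measurable_funTS; exact: cdf_measurable.
- by move=> t /=; rewrite !in_itv/= => /andP[].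
Qed.

(** Monotone convergence along [[y - n, y]], which exhaust the half-line. With [integral_cdfNy_ge]
    this identifies the expectation of the positive part of [y - X] with the supremum of [J y - J x]
    over [x]. *)
Lemma integral_cdfNy_le (y M : R) : (forall x, J y - J x <= M) ->
  (\int[P]_w (Num.max (y - X w) 0)%:E <= M%:E)%E.
Proof.
move=> JM; rewrite integral_cdfNy.
have -> : `]-oo, y]%classic = \bigcup_n `[y - n%:R, y]%classic.
  apply/seteqP; split=> [t|t [n _]] /=; rewrite !in_itv/=; last by case/andP.
  move=> ty; exists (Num.truncn (y - t)).+1 => //=; rewrite in_itv/= ty andbT.
  by rewrite lerBlDl -lerBlDr ltW// truncnS_gt.
have nd : nondecreasing_seq (fun n : nat => `[y - n%:R, y]%classic).
  move=> m n mn; apply/subsetPset => t /=; rewrite !in_itv/= => /andP[yt ->].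
  by rewrite andbT (le_trans _ yt)// lerB// ler_nat.
have mcdf (n : nat) : measurable_fun `[y - n%:R, y] (cdf X).
  by apply: measurable_funTS; exact: cdf_measurable.
have := ge0_nondecreasing_set_cvg_integral (mu := mu) nd _ mcdf.
move=> /(_ _ _)/cvg_lim <-//; apply: lime_le.
  apply: ereal_nondecreasing_is_cvgn.
  exact: ge0_nondecreasing_set_nondecreasing_integral.
by near=> n; rewrite integral_cdf ?lee_fin ?JM// gerBl.
Unshelve. all: by end_near. Qed.

(** The function [t - J t] does for [1 - F] what [J] does for [F]. *)
Lemma integral_ccdf (x y : R) : y <= x ->
  (\int[mu]_(t in `[y, x]) ccdf X t = ((x - J x) - (y - J y))%:E)%E.
Proof.
move=> yx; rewrite (_ : _ - _ = (x - y) - (J x - J y)); last by ring.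
rewrite EFinB -integral_cdf//.
under eq_integral do rewrite ccdf_1_cdf -EFin_fine_cdf.
under [in RHS]eq_integral do rewrite -EFin_fine_cdf.
rewrite integralB_EFin//=; last 2 first.
- apply: (@measurable_bounded_integrable _ _ _ mu (cst 1)) => //.
  + exact: lebesgue_measure_itvcc_lty.
  + exact: bounded_cst.
- exact: fine_cdf_integrable.
congr (_ - _)%E; rewrite integral_cst//= mul1e lebesgue_measure_itv/= lte_fin.
by case: ltgtP yx => //= -> _; rewrite subrr.
Qed.

Lemma integral_ccdfy_ge (x y : R) :
  (((x - J x) - (y - J y))%:E <= \int[P]_w (Num.max (X w - y) 0)%:E)%E.
Proof.
have [yx|xy] := leP y x; last first.
  apply: (@le_trans _ _ 0%E); last first.
    by apply: integral_ge0 => w _; rewrite lee_fin le_max lexx orbT.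
  rewrite lee_fin; have /andP[_] := integrated_cdf_slope (ltW xy).
  have : fine (cdf X y) * (y - x) <= y - x.
    by rewrite ler_piMl ?fine_cdf_le1// subr_ge0 ltW.
  lra.
rewrite -integral_ccdf// integral_ccdfy; apply: ge0_subset_integral => //.
- by apply: measurable_funTS; exact: ccdf_measurable.
- by move=> t /=; rewrite !in_itv/= => /andP[->].
Qed.

Lemma integral_ccdfy_le (y M : R) : (forall x, (x - J x) - (y - J y) <= M) ->
  (\int[P]_w (Num.max (X w - y) 0)%:E <= M%:E)%E.
Proof.
move=> JM; rewrite integral_ccdfy.
have -> : `[y, +oo[%classic = \bigcup_n `[y, y + n%:R]%classic.
  apply/seteqP; split=> [t|t [n _]] /=; rewrite !in_itv/= andbT;
    last by case/andP.
  move=> ty; exists (Num.truncn (t - y)).+1 => //=; rewrite in_itv/= ty/=.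
  by rewrite -lerBlDl ltW// truncnS_gt.
have nd : nondecreasing_seq (fun n : nat => `[y, y + n%:R]%classic).
  move=> m n mn; apply/subsetPset => t /=; rewrite !in_itv/= => /andP[-> ty].
  by rewrite (le_trans ty)// lerD2l ler_nat.
have mccdf (n : nat) : measurable_fun `[y, y + n%:R] (ccdf X).
  by apply: measurable_funTS; exact: ccdf_measurable.
have := ge0_nondecreasing_set_cvg_integral (mu := mu) nd _ mccdf.
move=> /(_ _ _)/cvg_lim <-//; apply: lime_le.
  apply: ereal_nondecreasing_is_cvgn.
  exact: ge0_nondecreasing_set_nondecreasing_integral.
by near=> n; rewrite integral_ccdf ?lee_fin ?JM// lerDl.
Unshelve. all: by end_near. Qed.

End cdf_integrals.

(** * Weak convergence and pointwise convergence of the integrated distribution functions *)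

Section integrated_cdf_cvg.
Context (R : realType).
Local Notation mu := (@lebesgue_measure R).

(** A [discontinuity] is a jump: both one-sided limits exist and differ. A distribution function is
    right-continuous and, being monotone and bounded, has left limits, so without a jump the left
    limit equals the value. *)
Lemma cdf_continuous_at (d : measure_display) (T : measurableType d)
    (P : probability T R) (X : {RV P >-> R}) (x : R) :
  ~ discontinuity (fun t => fine (cdf X t)) x -> {for x, continuous (cdf X)}.
Proof.
set f := fun t : R => _ => ndisc.
have fr : f t @[t --> x^'+] --> f x.
  by apply: fine_cvg; rewrite EFin_fine_cdf; exact: cdf_right_continuous.
have fl : cvg (f t @[t --> x^'-]).
  apply: nondecreasing_at_left_is_cvgr.
    by near=> y => s t _ _; exact: fine_cdf_nondecreasing.
  by near=> y; exists 1 => _ [t _ <-]; exact: fine_cdf_le1.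
have flx : f t @[t --> x^'-] --> f x.
  suff <- : lim (f t @[t --> x^'-]) = f x by [].
  rewrite -(cvg_lim _ fr)//; apply: contrapT => /eqP neq.
  by apply: ndisc; split => //; apply/cvg_ex; exists (f x).
have fx : f t @[t --> x] --> f x by apply/left_right_continuousP.
rewrite /prop_for /continuous_at -EFin_fine_cdf; apply: cvg_EFin => //.
by near=> t; rewrite fin_num_measure.
Unshelve. all: by end_near. Qed.

Context (d : nat -> measure_display) (T : forall n, measurableType (d n))
  (P : forall n, probability (T n) R) (X : forall n, {RV (P n) >-> R})
  (d' : measure_display) (T' : measurableType d') (P' : probability T' R)
  (Y : {RV P' >-> R}).

(** Dominated convergence on a compact interval with dominating function 1: the distribution
    functions converge outside the countable set of jumps of the limit. *)
Lemma integrated_cdf_cvg (XY : cvg_in_distribution X Y) (x : R) :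
  integrated_cdf (X n) x @[n --> \oo] --> integrated_cdf Y x.
Proof.
have cvg_itv (a b : R) : \int[mu]_(t in `[a, b]) fine (cdf (X n) t) @[n --> \oo]
    --> \int[mu]_(t in `[a, b]) fine (cdf Y t).
  have mcdf (d0 : measure_display) (T0 : measurableType d0)
      (P0 : probability T0 R) (Z : {RV P0 >-> R}) :
      measurable_fun `[a, b] (EFin \o (fun t => fine (cdf Z t))).
    exact: measurable_int (fine_cdf_integrable Z a b).
  have ff : {ae mu, forall t, (`[a, b]%classic : set R) t ->
      (EFin \o (fun t => fine (cdf (X n) t))) t @[n --> \oo] -->
      (EFin \o (fun t => fine (cdf Y t))) t}.
    (* The open interval is wider than [[a, b]] so that jumps at [a] and [b] are included. *)
    pose D := [set t | t \in (`]a - 1, b + 1[) /\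
      discontinuity (fun t => fine (cdf Y t)) t].
    have cD : countable D.
      apply: discontinuity_countable => s t _ _; exact: fine_cdf_nondecreasing.
    exists D; split.
    + exact: countable_measurable.
    + exact: countable_lebesgue_measure0.
    + move=> t /= /not_implyP[]; rewrite in_itv/= => /andP[at_ tb] ncvg; split.
        by rewrite in_itv/=; apply/andP; split; lra.
      apply: contrapT => /cdf_continuous_at /XY; apply: contra_not ncvg => ?.
      by rewrite EFin_fine_cdf; under eq_cvg do rewrite EFin_fine_cdf.
  have ig : mu.-integrable `[a, b] (cst 1%E : R -> \bar R).
    apply: (@measurable_bounded_integrable _ _ _ mu (cst 1)) => //.
    + exact: lebesgue_measure_itvcc_lty.
    + exact: bounded_cst.
  have fg : {ae mu, forall t n, (`[a, b]%classic : set R) t ->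
      (`|(EFin \o (fun t => fine (cdf (X n) t))) t| <= cst 1%E t)%E}.
    apply: aeW => t n _ /=; rewrite lee_fin.
    by rewrite ger0_norm ?fine_cdf_ge0 ?fine_cdf_le1.
  have [//|_ _] := dominated_convergence (mu := mu) _
    (fun n => mcdf _ _ _ (X n)) (mcdf _ _ _ Y) ff ig fg.
  move=> h; apply: fine_cvg; rewrite fineK//.
  exact: integrable_fin_num (fine_cdf_integrable Y a b).
rewrite /integrated_cdf; case: ifP => _; first exact: cvg_itv.
by apply: cvgN; exact: cvg_itv.
Qed.

End integrated_cdf_cvg.

(* The integrated distribution function of -X, if J is the one of X. *)
Definition reflected (R : realType) (J : R -> R) (x : R) : R := x + J (- x).

(* J n (- c) - J n x is the integral of the distribution function over
   [x, - c]. *)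
Definition tails_vanish (R : realType) (J : nat -> R -> R) : Prop :=
  forall e : R, 0 < e -> exists2 c, 0 <= c & forall n x, J n (- c) - J n x <= e.

(** * Uniform integrability *)

Section uniform_integrability.
Context (R : realType) (d : nat -> measure_display)
  (T : forall n, measurableType (d n)) (P : forall n, probability (T n) R).
Implicit Type Z : forall n, T n -> R.

Lemma max0_integral_le (n : nat) (f g : T n -> R) :
    measurable_fun setT f -> measurable_fun setT g ->
    (forall w, f w <= Num.max (g w) 0) ->
  (\int[P n]_w (Num.max (f w) 0)%:E <= \int[P n]_w (Num.max (g w) 0)%:E)%E.
Proof.
move=> mf mg fg; apply: ge0_le_integral => //.
- by move=> w _; rewrite lee_fin le_max lexx orbT.
- by apply/measurable_EFinP; exact: measurable_maxr.
- by apply/measurable_EFinP; exact: measurable_maxr.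
- by move=> w _; rewrite lee_fin ge_max fg le_max lexx orbT.
Qed.

(** The excess of [Z] over [c] is at most [Z] on [c < Z] and zero elsewhere. Conversely, for
    [b >= 2 * c], on [b < Z] the variable [Z] is at most twice its excess over [c]. The excess is
    the form that can be expressed by integrated distribution functions. *)
Lemma uniformly_integrable_excess Z :
    (forall n, measurable_fun setT (Z n)) -> (forall n w, 0 <= Z n w) ->
  uniformly_integrable P Z <->
  forall e : R, 0 < e -> exists2 c, 0 <= c &
    forall n, (\int[P n]_w (Num.max (Z n w - c) 0)%:E <= e%:E)%E.
Proof.
move=> mZ Z0.
have normZ n w : `|Z n w| = Z n w by rewrite ger0_norm.
have mtail n c : measurable [set w | c < Z n w].
  rewrite (_ : [set _ | _] = Z n @^-1` `]c, +oo[); last first.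
    by apply/seteqP; split => w /=; rewrite in_itv/= andbT.
  by rewrite -[X in measurable X]setTI; exact: mZ.
pose S (c : R) : \bar R := ereal_sup (range (fun n : nat =>
     \int[P n]_(w in [set w | (c < `|Z n w|)%R]) (`|Z n w|%R)%:E))%E.
rewrite /uniformly_integrable -/S; split=> [UI e e0|excess].
- have /fine_cvgP[finS /cvgrPdist_le/(_ _ e0) Se] : S c @[c --> +oo] --> 0%:E.
    exact: UI.
  have [c [c0 finc Sc]] : exists c : R,
      [/\ 0 <= c, S c \is a fin_num & `|0 - fine (S c)| <= e].
    near (+oo : set_system R) => c; exists c; split; near: c => //.
    exact: nbhs_pinfty_ge.
  exists c => // n.
  have : (\int[P n]_w (Num.max (Z n w - c) 0)%:E <=
      \int[P n]_(w in [set w | (c < `|Z n w|)%R]) (`|Z n w|%R)%:E)%E.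
    under [X in (_ <= \int[_]_(_ in X) _)%E]eq_set do rewrite normZ.
    rewrite [leRHS]integral_mkcond; apply: ge0_le_integral => //.
    + by move=> w _; rewrite lee_fin le_max lexx orbT.
    + apply/measurable_EFinP; apply: measurable_maxr => //.
      exact: measurable_funB.
    + apply/(measurable_restrictT _ _).1 => //.
      by apply/measurable_EFinP/measurable_funTS; exact: measurableT_comp.
    + move=> w _; rewrite patchE; case: ifPn => [_|]; rewrite lee_fin.
        by rewrite normZ ge_max Z0 andbT gerBl.
      by rewrite notin_setE/= ge_max lexx andbT subr_le0 => /negP; rewrite -leNgt.
  move=> /le_trans; apply; apply: (@le_trans _ _ (S c)).
    by apply: ereal_sup_ubound; exists n.
  rewrite -(fineK finc) lee_fin (le_trans (ler_norm _))//.
  by rewrite -normrN -sub0r.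
- have tail_le e : 0 < e -> \forall c \near +oo, (S c <= e%:E)%E.
    move=> e0; have [c c0 Zc] := excess _ (divr_gt0 e0 (@ltr0n R 2)).
    near=> b; apply: ge_ereal_sup => _ [n _ <-].
    have b2c : 2 * c <= b by near: b; apply: nbhs_pinfty_ge; rewrite num_real.
    apply: (@le_trans _ _ (2%:E * (e / 2)%:E)%E); last first.
      by rewrite -EFinM mulrC divfK.
    apply: (@le_trans _ _ (2%:E * \int[P n]_w (Num.max (Z n w - c) 0)%:E)%E).
      rewrite -ge0_integralZl//; last first.
      + by move=> w _; rewrite lee_fin le_max lexx orbT.
      + apply/measurable_EFinP; apply: measurable_maxr => //.
        exact: measurable_funB.
      under [X in (\int[_]_(_ in X) _ <= _)%E]eq_set do rewrite normZ.
      rewrite [leLHS]integral_mkcond; apply: ge0_le_integral => //.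
      + by move=> w _; apply: erestrict_ge0 => ? _; rewrite lee_fin.
      + apply/(measurable_restrictT _ _).1 => //.
        by apply/measurable_EFinP/measurable_funTS; exact: measurableT_comp.
      + apply: measurable_funeM; apply/measurable_EFinP.
        apply: measurable_maxr => //.
        exact: measurable_funB.
      + move=> w _; rewrite patchE; case: ifPn => [|_].
          rewrite inE/= normZ -EFinM lee_fin => bZ.
          have : Z n w - c <= Num.max (Z n w - c) 0 by rewrite le_max lexx.
          lra.
        by rewrite -EFinM lee_fin mulr_ge0// le_max lexx orbT.
    by rewrite lee_pmul2l// lte_fin.
  (* Being nonnegative, [S c] is finite as soon as it is bounded above by a real. *)
  have sup_ge0 c : (0 <= S c)%E.
    apply: (@le_trans _ _ (\int[P 0%N]_(w in [set w | (c < `|Z 0%N w|)%R])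
       (`|Z 0%N w|%R)%:E)%E).
      by apply: integral_ge0 => w _; rewrite lee_fin.
    by apply: ereal_sup_ubound; exists 0%N.
  apply/fine_cvgP; split.
    apply: filterS (tail_le 1 ltr01) => c ce.
    by rewrite ge0_fin_numE// (le_lt_trans ce)// ltry.
  apply/cvgrPdist_le => e e0; apply: filterS (tail_le e e0) => c ce /=.
  have fc : S c \is a fin_num.
    by rewrite ge0_fin_numE// (le_lt_trans ce)// ltry.
  by rewrite sub0r normrN ger0_norm ?fine_ge0// -lee_fin fineK.
Unshelve. all: by end_near. Qed.

End uniform_integrability.

(** * Integrability and uniform integrability in terms of integrated distribution functions *)

Section random_variable_bridge.
Context (R : realType).

Lemma integrated_cdf0 (d : measure_display) (T : measurableType d)
  (P : probability T R) (X : {RV P >-> R}) : integrated_cdf X 0 = 0.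
Proof. by rewrite /integrated_cdf lexx set_itv1 Rintegral_set1. Qed.

(** The case [y = 0] of the lower bound for the expectation of the positive part of [y - X].
    Integrability of the negative part enters the main argument only through this bound, which makes
    the conjugate finite at 0. *)
Lemma integrated_cdf_bounded (d : measure_display) (T : measurableType d)
    (P : probability T R) (X : {RV P >-> R}) :
  ('E_P[(X : T -> R)^\-%R] < +oo)%E ->
  exists M, forall x, - integrated_cdf X x <= M.
Proof.
rewrite expectation_def => EX.
exists (fine (\int[P]_w ((X : T -> R)^\- w)%:E)) => x.
rewrite -lee_fin fineK; last first.
  rewrite ge0_fin_numE//; apply: integral_ge0 => w _.
  by rewrite lee_fin funrneg_ge0.
have := integral_cdfNy_ge X x 0; rewrite integrated_cdf0 sub0r.
by under eq_integral do rewrite sub0r.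
Qed.

Lemma reflected_integrated_cdf_bounded (d : measure_display)
    (T : measurableType d) (P : probability T R) (X : {RV P >-> R}) :
  ('E_P[(X : T -> R)^\+%R] < +oo)%E ->
  exists M, forall x, - reflected (integrated_cdf X) x <= M.
Proof.
rewrite expectation_def => EX.
exists (fine (\int[P]_w ((X : T -> R)^\+ w)%:E)) => x.
rewrite -lee_fin fineK; last first.
  rewrite ge0_fin_numE//; apply: integral_ge0 => w _.
  by rewrite lee_fin funrpos_ge0.
have := integral_ccdfy_ge X (- x) 0; rewrite integrated_cdf0 !subr0 /reflected.
by rewrite opprD; under eq_integral do rewrite subr0.
Qed.

Lemma expectation_funrneg_lty (d : measure_display) (T : measurableType d)
    (P : probability T R) (X : {RV P >-> R}) :
  ('E_P[fun w => `|X w|%R] < +oo)%E -> ('E_P[(X : T -> R)^\-%R] < +oo)%E.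
Proof.
rewrite unlock; apply: le_lt_trans; apply: ge0_le_integral => //.
- by move=> w _; rewrite lee_fin funrneg_ge0.
- by apply/measurable_EFinP; apply: measurable_funrneg.
- by apply/measurable_EFinP; exact: measurableT_comp.
- move=> w _; rewrite lee_fin /funrneg ge_max normr_ge0 andbT -normrN.
  exact: ler_norm.
Qed.

Lemma expectation_funrpos_lty (d : measure_display) (T : measurableType d)
    (P : probability T R) (X : {RV P >-> R}) :
  ('E_P[fun w => `|X w|%R] < +oo)%E -> ('E_P[(X : T -> R)^\+%R] < +oo)%E.
Proof.
rewrite unlock; apply: le_lt_trans; apply: ge0_le_integral => //.
- by move=> w _; rewrite lee_fin funrpos_ge0.
- by apply/measurable_EFinP; apply: measurable_funrpos.
- by apply/measurable_EFinP; exact: measurableT_comp.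
- by move=> w _; rewrite lee_fin /funrpos ge_max normr_ge0 andbT ler_norm.
Qed.

Context (d : nat -> measure_display) (T : forall n, measurableType (d n))
  (P : forall n, probability (T n) R) (X : forall n, {RV (P n) >-> R}).

Lemma max0B (x c : R) : 0 <= c ->
  Num.max (Num.max x 0 - c) 0 = Num.max (x - c) 0.
Proof.
by move=> c0; rewrite /Num.max; case: (ltP x 0) => ?; do !case: ltP => ?; lra.
Qed.

Lemma funrneg_excess (n : nat) (c : R) (w : T n) : 0 <= c ->
  Num.max ((X n : T n -> R)^\- w - c) 0 = Num.max (- c - X n w) 0.
Proof. by move=> c0; rewrite /funrneg max0B// addrC. Qed.

Lemma funrpos_excess (n : nat) (c : R) (w : T n) : 0 <= c ->
  Num.max ((X n : T n -> R)^\+ w - c) 0 = Num.max (X n w - c) 0.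
Proof. by move=> c0; rewrite /funrpos max0B. Qed.

(** For [c >= 0] the excess of the negative part over [c] is the positive part of [- c - X n], whose
    expectation is the supremum over [x] of [J (- c) - J x]. *)
Lemma uniformly_integrable_funrneg :
  uniformly_integrable P (fun n => (X n : T n -> R)^\-) <->
  tails_vanish (fun n => integrated_cdf (X n)).
Proof.
rewrite uniformly_integrable_excess; last 2 first.
- by move=> n; exact: measurable_funrneg.
- by move=> n w; exact: funrneg_ge0.
split=> h e e0; have [c c0 hc] := h e e0; exists c => //.
- move=> n x; rewrite -lee_fin (le_trans _ (hc n))//.
  under eq_integral do rewrite funrneg_excess//.
  exact: integral_cdfNy_ge.
- move=> n; under eq_integral do rewrite funrneg_excess//.
  exact: integral_cdfNy_le.
Qed.

Lemma uniformly_integrable_funrpos :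
  uniformly_integrable P (fun n => (X n : T n -> R)^\+) <->
  tails_vanish (fun n => reflected (integrated_cdf (X n))).
Proof.
rewrite uniformly_integrable_excess; last 2 first.
- by move=> n; exact: measurable_funrpos.
- by move=> n w; exact: funrpos_ge0.
split=> h e e0; have [c c0 hc] := h e e0; exists c => //.
- move=> n x; rewrite -lee_fin (le_trans _ (hc n))//.
  under eq_integral do rewrite funrpos_excess//.
  apply: le_trans (integral_ccdfy_ge _ (- x) _).
  by rewrite lee_fin /reflected opprK; lra.
- move=> n; under eq_integral do rewrite funrpos_excess//.
  apply: integral_ccdfy_le => x; have := hc n (- x).
  by rewrite /reflected !opprK; lra.
Qed.

(** For [c >= 0] at most one of the two parts exceeds [c], so the excess of the absolute value is
    the sum of the excesses of the parts. *)
Lemma uniformly_integrable_norm :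
  uniformly_integrable P (fun n w => `|X n w|) <->
  uniformly_integrable P (fun n => (X n : T n -> R)^\-) /\
  uniformly_integrable P (fun n => (X n : T n -> R)^\+).
Proof.
have mneg n : measurable_fun setT (X n : T n -> R)^\-.
  exact: measurable_funrneg.
have mpos n : measurable_fun setT (X n : T n -> R)^\+.
  exact: measurable_funrpos.
have mnorm n : measurable_fun setT (fun w => `|X n w|).
  exact: measurableT_comp.
have neg0 n w : 0 <= (X n : T n -> R)^\- w by exact: funrneg_ge0.
have pos0 n w : 0 <= (X n : T n -> R)^\+ w by exact: funrpos_ge0.
rewrite !uniformly_integrable_excess//.
have leneg n w : (X n : T n -> R)^\- w <= `|X n w|.
  by rewrite /funrneg ge_max normr_ge0 andbT -normrN ler_norm.
have lepos n w : (X n : T n -> R)^\+ w <= `|X n w|.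
  by rewrite /funrpos ge_max normr_ge0 andbT ler_norm.
have mB n (f : T n -> R) (c : R) : measurable_fun setT f ->
    measurable_fun setT (fun w => f w - c).
  by move=> mf; exact: measurable_funB.
split=> [h|[hneg hpos] e e0].
- split=> e e0; have [c c0 hc] := h e e0; exists c => // n;
    apply: le_trans (hc n); apply: max0_integral_le; try exact: mB;
    by move=> w; rewrite le_max lerB.
- have [c1 c10 hc1] := hneg _ (divr_gt0 e0 (@ltr0n R 2)).
  have [c2 c20 hc2] := hpos _ (divr_gt0 e0 (@ltr0n R 2)).
  (* Raising the level only lowers the excess, so the larger level serves both parts. *)
  exists (Num.max c1 c2) => [|n]; first by rewrite le_max c10.
  set c := Num.max c1 c2.
  have c0 : 0 <= c by rewrite le_max c10.
  have -> : (\int[P n]_w (Num.max (`|X n w| - c) 0)%:E =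
      \int[P n]_w ((Num.max ((X n : T n -> R)^\- w - c) 0)%:E +
                   (Num.max ((X n : T n -> R)^\+ w - c) 0)%:E))%E.
    apply: eq_integral => w _; rewrite -EFinD; congr (_%:E).
    rewrite funrneg_excess// funrpos_excess//.
    move: (X n w) => x; case: (ger0P x) => x0.
      by rewrite /Num.max; do !case: ltP => ?; lra.
    by rewrite /Num.max; do !case: ltP => ?; lra.
  rewrite ge0_integralD//=; last 4 first.
  + by move=> w _; rewrite lee_fin le_max lexx orbT.
  + by apply/measurable_EFinP; apply: measurable_maxr => //; exact: mB.
  + by move=> w _; rewrite lee_fin le_max lexx orbT.
  + by apply/measurable_EFinP; apply: measurable_maxr => //; exact: mB.
  rewrite [e]splitr EFinD leeD//.
  + apply: le_trans (hc1 n); apply: max0_integral_le; try exact: mB.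
    by move=> w; rewrite le_max lerB// le_max lexx.
  + apply: le_trans (hc2 n); apply: max0_integral_le; try exact: mB.
    by move=> w; rewrite le_max lerB// le_max lexx orbT.
Qed.

End random_variable_bridge.

(** * Conjugates of convex functions *)

Section convex_conjugate.
Context (R : realType).
Implicit Types (J : R -> R) (A B : set R) (b c e u v x y z : R).

(** The Fenchel transform of an arbitrary function; at [integrated_cdf X] it unfolds to
    [integrated_quantile X], so the analysis below needs no random variables. *)
Definition conjugate J u : \bar R :=
  ereal_sup (range (fun x : R => (x * u - J x)%:E)).

(* The third clause is convexity: the slope on [x, y] is at most the slope on
   [y, z]. *)
Definition idf_like J : Prop :=
  [/\ J 0 = 0,
      forall x y, x <= y -> 0 <= J y - J x <= y - x,
      forall x y z, x <= y -> y <= z ->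
        (J y - J x) * (z - y) <= (J z - J y) * (y - x),
      forall b, b < 1 -> exists c, forall x, c <= x -> b * (x - c) <= J x - J c
    & forall b, 0 < b ->
        exists c, forall x, x <= c -> J c - J x <= b * (c - x)].

Lemma conjugate_ub J u x : ((x * u - J x)%:E <= conjugate J u)%E.
Proof. by apply: ereal_sup_ubound; exists x. Qed.

Lemma conjugate_le J u (M : \bar R) :
  (forall x, ((x * u - J x)%:E <= M)%E) -> (conjugate J u <= M)%E.
Proof. by move=> h; apply: ge_ereal_sup => _ [x _ <-]. Qed.

Lemma conjugate_reflected J u : conjugate (reflected J) u = conjugate J (1 - u).
Proof.
apply/eqP; rewrite eq_le; apply/andP; split; apply: conjugate_le => x.
- apply: le_trans (conjugate_ub _ _ (- x)).
  by rewrite lee_fin /reflected; lra.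
- apply: le_trans (conjugate_ub _ _ (- x)).
  by rewrite lee_fin /reflected opprK; lra.
Qed.

(** Reflection turns a slope [b] into [1 - b] and swaps the two ends, so the last two clauses are
    exchanged. *)
Lemma idf_like_reflected J : idf_like J -> idf_like (reflected J).
Proof.
move=> [J0 Jlip Jconv Jy JNy]; rewrite /reflected; split.
- by rewrite oppr0 J0 addr0.
- move=> x y xy; have := Jlip (- y) (- x); rewrite lerN2 => /(_ xy); lra.
- move=> x y z xy yz; have := Jconv (- z) (- y) (- x).
  by rewrite !lerN2 => /(_ yz xy); lra.
- move=> b b1; have [|c hc] := JNy (1 - b); first by rewrite subr_gt0.
  exists (- c) => x cx; have /hc : - x <= c by lra.
  by rewrite !opprK; lra.
- move=> b b0; have [|c hc] := Jy (1 - b); first by rewrite gtrBl.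
  exists (- c) => x cx; have /hc : c <= - x by lra.
  by rewrite !opprK; lra.
Qed.

Lemma idf_like_lip J x y : idf_like J -> `|J x - J y| <= `|x - y|.
Proof.
move=> [_ Jlip _ _ _]; case: (leP x y) => [xy|/ltW xy].
  by rewrite distrC (distrC x) !ger0_norm; have := Jlip _ _ xy; lra.
by rewrite !ger0_norm; have := Jlip _ _ xy; lra.
Qed.

Lemma idf_like_norm J x : idf_like J -> `|J x| <= `|x|.
Proof.
move=> Ji; have := idf_like_lip x 0 Ji.
by case: Ji => -> _ _ _ _; rewrite !subr0.
Qed.

(** * Restricting the supremum to a bounded set, up to an error *)

Definition right_cut J A c e : Prop :=
  forall u x, A u -> c <= x -> x * u - J x <= c * u - J c + e.

Definition left_cut J A c e : Prop :=
  forall u x, A u -> x <= c -> x * u - J x <= c * u - J c + e.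

Definition cutoff J A c e : Prop :=
  forall u x, A u -> exists2 y, `|y| <= c & x * u - J x <= y * u - J y + e.

(** Only large [n] are considered, since pointwise convergence does not control the first terms. On
    a constant sequence this becomes a property of a single function. *)
Definition right_tight (J : nat -> R -> R) A : Prop :=
  forall e, 0 < e -> exists c, \forall n \near \oo, right_cut (J n) A c e.

Definition left_tight (J : nat -> R -> R) A : Prop :=
  forall e, 0 < e -> exists c, \forall n \near \oo, left_cut (J n) A c e.

Definition tight (J : nat -> R -> R) A : Prop :=
  forall e, 0 < e -> exists c, \forall n \near \oo, cutoff (J n) A c e.

Lemma tightI (J : nat -> R -> R) A :
  left_tight J A -> right_tight J A -> tight J A.
Proof.
move=> lt rt e e0; have [c1 h1] := lt e e0; have [c2 h2] := rt e e0.
exists (Num.max `|c1| `|c2|); near=> n.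
have l1 : left_cut (J n) A c1 e by near: n.
have l2 : right_cut (J n) A c2 e by near: n.
move=> u x Au; case: (leP x c1) => [xc1|c1x].
  by exists c1; [rewrite le_max lexx|exact: l1].
case: (leP c2 x) => [c2x|xc2].
  by exists c2; [rewrite le_max lexx orbT|exact: l2].
exists x; last by rewrite lerDl ltW.
rewrite ler_norml; apply/andP; split.
  rewrite lerNl le_max; apply/orP; left; rewrite -normrN.
  by rewrite (le_trans _ (ler_norm _))// lerN2 ltW.
by rewrite le_max; apply/orP; right; exact: le_trans (ltW xc2) (ler_norm _).
Unshelve. all: by end_near. Qed.

(** For [u >= 0] the term [x * u] only decreases to the left of [- c], so the bound at [u = 0] is
    good for all of [A]. *)
Lemma tails_vanish_left_tight (J : nat -> R -> R) A :
  A `<=` [set u | 0 <= u] -> tails_vanish J -> left_tight J A.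
Proof.
move=> A0 h e e0; have [c c0 hc] := h e e0; exists (- c); near=> n => u x Au xc.
have := hc n x; have : x * u <= - c * u by rewrite ler_wpM2r//; exact: A0.
lra.
Unshelve. all: by end_near. Qed.

Lemma tails_vanish_right_tight (J : nat -> R -> R) A :
  A `<=` [set u | u <= 1] -> tails_vanish (fun n => reflected (J n)) ->
  right_tight J A.
Proof.
move=> A1 h e e0; have [c c0 hc] := h e e0; exists c; near=> n => u x Au cx.
have := hc n (- x); rewrite /reflected !opprK.
have : c * (1 - u) <= x * (1 - u) by rewrite ler_wpM2r// subr_ge0; exact: A1.
lra.
Unshelve. all: by end_near. Qed.

(** A point where [- J] is within [e] of its supremum may be moved left to some [- c] with [c >= 0],
    because [J] is nondecreasing. *)
Lemma tails_vanish_cst J : idf_like J -> (exists M, forall x, - J x <= M) ->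
  tails_vanish (fun=> J).
Proof.
move=> [_ Jlip _ _ _] [M JM] e e0.
have hs : has_sup (range (fun x => - J x)).
  by split; [exists (- J 0), 0|exists M => _ [x _ <-]].
have [_ [x0 _ <-] hx0] := sup_adherent e0 hs.
exists (Num.max (- x0) 0); first by rewrite le_max lexx orbT.
move=> _ x; have : - J x <= sup (range (fun x => - J x)).
  by apply: (sup_upper_bound hs); exists x.
have /Jlip : - Num.max (- x0) 0 <= x0 by rewrite lerNl le_max lexx.
lra.
Qed.

Section convergent_sequence.
Context (Js : nat -> R -> R) (J : R -> R)
  (idfJs : forall n, idf_like (Js n)) (idfJ : idf_like J)
  (cvgJ : forall x, Js n x @[n --> \oo] --> J x).

Lemma near_close x e : 0 < e -> \forall n \near \oo, `|J x - Js n x| <= e.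
Proof. by move=> e0; have /cvgrPdist_le := @cvgJ x; exact. Qed.

(** On some [[c, c + 1]] the limit has slope well above [b], hence [Js n] has slope at least [b]
    there for large [n]. Convexity carries this slope to the right, where [x * u - Js n x] therefore
    no longer increases. *)
Lemma right_tight_cvg A b :
  b < 1 -> A `<=` [set u | u <= b] -> right_tight Js A.
Proof.
move=> b1 Ab e e0; have [_ _ _ Jy _] := idfJ.
have [|c hc] := Jy ((b + 1) / 2); first lra.
(* Two errors of this size add up to [(1 - b) / 2], the gap between the slope [(b + 1) / 2] and
   [b]. *)
have d0 : 0 < (1 - b) / 4 by lra.
exists (c + 1); near=> n => u x Au cx.
have [_ _ Jconv _ _] := idfJs n.
have close1 : `|J c - Js n c| <= (1 - b) / 4 by near: n; exact: near_close.
have close2 : `|J (c + 1) - Js n (c + 1)| <= (1 - b) / 4.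
  by near: n; exact: near_close.
have slope : b <= Js n (c + 1) - Js n c.
  move: close1 close2; rewrite !ler_norml => /andP[? ?] /andP[? ?].
  by have := hc (c + 1); rewrite lerDl ler01 => /(_ isT); lra.
have := Jconv c (c + 1) x; rewrite lerDl ler01 => /(_ isT cx).
have : b * (x - (c + 1)) <= (Js n (c + 1) - Js n c) * (x - (c + 1)).
  by rewrite ler_wpM2r// subr_ge0.
have : u * (x - (c + 1)) <= b * (x - (c + 1)).
  by rewrite ler_wpM2r ?subr_ge0//; exact: Ab.
lra.
Unshelve. all: by end_near. Qed.

(** Closeness on a finite grid of mesh [e / 3] spreads to the interval: [J] and [Js n], both
    1-Lipschitz, each change by at most [e / 3] between [y] and the grid point below it. *)
Lemma near_close_itv c e : 0 < e ->
  \forall n \near \oo, forall y, `|y| <= c -> `|J y - Js n y| <= e.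
Proof.
move=> e0; pose dl := e / 3; have dl0 : 0 < dl by rewrite divr_gt0.
pose m := (Num.truncn ((c + c) / dl)).+1.
have grid : \forall n \near \oo, forall k : 'I_m,
    `|J (- c + k%:R * dl) - Js n (- c + k%:R * dl)| <= dl.
  by apply: filter_forall => k; exact: near_close.
apply: filterS grid => n grid y; rewrite ler_norml => /andP[cy yc].
have yc0 : 0 <= (y + c) / dl by rewrite divr_ge0 ?(ltW dl0)//; lra.
have km : (Num.truncn ((y + c) / dl) < m)%N.
  rewrite ltnS; apply: le_truncn; rewrite ler_pM2r ?invr_gt0//; lra.
have := grid (Ordinal km) => /=; set k := Num.truncn _.
set p := - c + _ => hp.
have [kle ltk] : k%:R * dl <= y + c /\ y + c < (k%:R + 1) * dl.
  have /andP[] := truncn_itv yc0.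
  by rewrite -/k -natr1 ler_pdivlMr// ltr_pdivrMr.
have yp : `|y - p| <= dl by rewrite ler_norml /p; lra.
have Jyp := le_trans (idf_like_lip y p idfJ) yp.
have Jnyp := le_trans (idf_like_lip y p (idfJs n)) yp.
have -> : J y - Js n y = (J y - J p) + (J p - Js n p) - (Js n y - Js n p).
  by ring.
rewrite (le_trans (ler_normB _ _))//.
rewrite (le_trans (lerD (ler_normD _ _) (lexx _)))//.
by rewrite /dl in Jyp Jnyp hp *; lra.
Qed.

Lemma tight_uniform_fin A e' : 0 < e' -> tight Js A ->
  \forall n \near \oo, forall u, A u -> conjugate J u \is a fin_num /\
    (`|conjugate (Js n) u - (fine (conjugate J u))%:E| < e'%:E)%E.
Proof.
(* The bounds [upper] and [lower] below cost [2 * e] and [4 * e], both strictly less than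
   [5 * e]. *)
move=> e'0 tJs; pose e := e' / 5.
have e0 : 0 < e by rewrite divr_gt0.
have [c hc] := tJs e e0.
have [N _ hN] : \forall n \near \oo, cutoff (Js n) A c e /\
    (forall y, `|y| <= c -> `|J y - Js n y| <= e).
  by near=> n; split; near: n => //; exact: near_close_itv.
(* The limit inherits the cut-off. As [x] is unbounded, [m] is chosen after [x], while [c] and the
   closeness on [[- c, c]] do not depend on [x]. *)
have approx u x : A u ->
    exists2 y, `|y| <= c & x * u - J x <= y * u - J y + 3 * e.
  move=> Au; near \oo => m.
  have Nm : (N <= m)%N by near: m; exact: nbhs_infty_ge.
  have [cut close] := hN m Nm.
  have [y yc hy] := cut u x Au; exists y => //.
  have := close y yc; have : `|J x - Js m x| <= e by near: m; exact: near_close.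
  by rewrite !ler_norml => /andP[? ?] /andP[? ?]; lra.
exists N => // n Nn u Au; have [cut close] := hN n Nn.
have finJ : conjugate J u \is a fin_num.
  rewrite fin_numElt; apply/andP; split.
    by apply: lt_le_trans (conjugate_ub J u 0); rewrite ltNyr.
  apply: (@le_lt_trans _ _ (c * `|u| + c + 3 * e)%:E); last exact: ltry.
  apply: conjugate_le => x; have [y yc hy] := approx u x Au.
  rewrite lee_fin (le_trans hy)// lerD2r lerD//.
    by rewrite (le_trans (ler_norm _))// normrM ler_wpM2r.
  by rewrite (le_trans _ yc)// (le_trans (ler_norm _))// normrN idf_like_norm.
have upper : (conjugate (Js n) u <= (fine (conjugate J u) + 2 * e)%:E)%E.
  apply: conjugate_le => x; have [y yc hy] := cut u x Au.
  have := close y yc; have := conjugate_ub J u y.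
  rewrite -(fineK finJ) !lee_fin !ler_norml => ? /andP[? ?]; lra.
have finJn : conjugate (Js n) u \is a fin_num.
  rewrite fin_numElt; apply/andP; split.
    by apply: lt_le_trans (conjugate_ub (Js n) u 0); rewrite ltNyr.
  by apply: le_lt_trans upper _; rewrite ltry.
have lower : (conjugate J u <= (fine (conjugate (Js n) u) + 4 * e)%:E)%E.
  apply: conjugate_le => x; have [y yc hy] := approx u x Au.
  have := close y yc; have := conjugate_ub (Js n) u y.
  rewrite -(fineK finJn) !lee_fin !ler_norml => ? /andP[? ?]; lra.
move: upper lower; rewrite -(fineK finJ) -(fineK finJn) !lee_fin => upper lower.
split => //; rewrite -EFinB abse_EFin lte_fin ltr_norml; apply/andP.
by rewrite /e in upper lower; split; lra.
Unshelve. all: by end_near. Qed.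

Lemma tight_uniform A : tight Js A ->
  cvg_uniformly_on A (fun n => conjugate (Js n))
    (fun u => fine (conjugate J u)).
Proof.
move=> tJs e e0; apply: filterS (tight_uniform_fin e0 tJs) => n h u Au.
by have [] := h u Au.
Qed.

Lemma tight_fin A u : tight Js A -> A u -> conjugate J u \is a fin_num.
Proof.
move=> tJs Au.
by have [n _ /(_ n (leqnn n) u Au)[]] := tight_uniform_fin ltr01 tJs.
Qed.

End convergent_sequence.

Lemma cvg_uniformly_on_fin A (K : nat -> R -> \bar R) (f : R -> R) e :
    0 < e -> cvg_uniformly_on A K f ->
  \forall n \near \oo, forall u, A u ->
    K n u \is a fin_num /\ `|fine (K n u) - f u| < e.
Proof.
move=> e0 /(_ e e0); apply: filterS => n h u /h.
by case: (K n u) => [k||]//=; rewrite lte_fin.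
Qed.

Lemma cvg_uniformly_on_cvg A (K : nat -> R -> \bar R) (f : R -> R) u :
  A u -> cvg_uniformly_on A K f -> K n u @[n --> \oo] --> (f u)%:E.
Proof.
move=> Au Kf; apply/fine_cvgP; split.
  by apply: filterS (cvg_uniformly_on_fin ltr01 Kf) => n /(_ u Au)[].
apply/cvgrPdist_lt => e e0.
apply: filterS (cvg_uniformly_on_fin e0 Kf) => n /(_ u Au)[_].
by rewrite distrC.
Qed.

Lemma conjugate_cutoff_lip J B c e u v : cutoff J B c e -> B u -> B v ->
    conjugate J u \is a fin_num -> conjugate J v \is a fin_num ->
  fine (conjugate J v) <= fine (conjugate J u) + c * `|v - u| + e.
Proof.
move=> cut Bu Bv finu finv; rewrite -lee_fin (fineK finv).
apply: conjugate_le => x; have [y yc hy] := cut v x Bv.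
have := conjugate_ub J u y; rewrite -(fineK finu) !lee_fin => hu.
have : y * (v - u) <= c * `|v - u|.
  by rewrite (le_trans (ler_norm _))// normrM ler_wpM2r.
lra.
Qed.

(** A uniform limit of functions that are Lipschitz up to [e]. The set [B] is a relative
    neighbourhood of [u], since on a half-open interval uniformity holds only on compact parts. The
    cut-off may depend on [n], as a single [n] is used. *)
Lemma conjugate_limit_continuous A (Js : nat -> R -> R) (f : R -> R) :
    (forall u, A u -> exists B, [/\ B u, \forall v \near u, A v -> B v,
       cvg_uniformly_on B (fun n => conjugate (Js n)) f &
       forall n, tight (fun=> Js n) B]) ->
  {within A, continuous f}.
Proof.
move=> hA; apply/subspace_continuousP => u Au; apply/cvgrPdist_le => e' e'0.
have [B [Bu AB Kf tB]] := hA u Au.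
(* Two comparisons of [f] with the conjugate, one Lipschitz term and one cut-off error, each at most
   [e]. *)
pose e := e' / 4; have e0 : 0 < e by rewrite divr_gt0.
near \oo => n.
have hn : forall u, B u -> conjugate (Js n) u \is a fin_num /\
    `|fine (conjugate (Js n) u) - f u| < e.
  by near: n; exact: cvg_uniformly_on_fin.
have [c /(@filter_ex _ _ _)[_ cut]] := tB n e e0.
have c1 : 0 < `|c| + 1 by rewrite ltr_pwDr.
rewrite near_withinE; near=> v => Av.
have Bv : B v by move: Av; near: v.
have vu : `|v - u| <= e / (`|c| + 1).
  rewrite distrC; near: v; apply: cvgr_dist_le; first exact: cvg_id.
  by rewrite divr_gt0.
have cvu : c * `|v - u| <= e.
  rewrite (@le_trans _ _ ((`|c| + 1) * `|v - u|))//.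
    by rewrite ler_wpM2r// (le_trans (ler_norm _))// lerDl.
  by rewrite mulrC -ler_pdivlMr.
have [finu] := hn u Bu; have [finv] := hn v Bv.
have := conjugate_cutoff_lip cut Bu Bv finu finv.
have := conjugate_cutoff_lip cut Bv Bu finv finu.
rewrite (distrC u) !ltr_norml ler_norml => ? ? /andP[? ?] /andP[? ?].
by apply/andP; have : e = e' / 4 by []; rewrite /from_subspace; split; lra.
Unshelve. all: by end_near. Qed.

Lemma left_tight_cvg (Js : nat -> R -> R) J A b :
    (forall n, idf_like (Js n)) -> idf_like J ->
    (forall x, Js n x @[n --> \oo] --> J x) ->
  0 < b -> A `<=` [set u | b <= u] -> left_tight Js A.
Proof.
move=> idfJs idfJ cvgJ b0 Ab e e0.
have [] := @right_tight_cvg (fun n => reflected (Js n)) (reflected J) _ _ _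
  [set u | A (1 - u)] (1 - b) _ _ e e0.
- by move=> n; exact: idf_like_reflected.
- exact: idf_like_reflected.
- by move=> x; apply: cvgD; [exact: cvg_cst|exact: cvgJ].
- by rewrite gtrBl.
- by move=> u /= /Ab/=; lra.
- move=> c hc; exists (- c); apply: filterS hc => n hc u x Au xc.
  have := hc (1 - u) (- x); rewrite /= /reflected !opprK subKr.
  by rewrite lerNr => /(_ Au xc); lra.
Qed.

(** The singleton [[set u]] stays away from 0 and 1, so the slopes alone give tightness on both
    sides, and uniform convergence on it is convergence at [u]. *)
Lemma conjugate_cvg_interior (Js : nat -> R -> R) J u :
    (forall n, idf_like (Js n)) -> idf_like J ->
    (forall x, Js n x @[n --> \oo] --> J x) -> 0 < u -> u < 1 ->
  conjugate J u \is a fin_num /\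
  conjugate (Js n) u @[n --> \oo] --> (fine (conjugate J u))%:E.
Proof.
move=> idfJs idfJ cvgJ u0 u1; have tJs : tight Js [set u].
  apply: tightI.
    by apply: (left_tight_cvg idfJs idfJ cvgJ u0) => _ -> /=.
  by apply: (right_tight_cvg idfJs idfJ cvgJ u1) => _ -> /=.
split; first exact: (tight_fin idfJs idfJ cvgJ tJs).
exact: (@cvg_uniformly_on_cvg [set u] _ (fun u => fine (conjugate J u)) u erefl
  (tight_uniform idfJs idfJ cvgJ tJs)).
Qed.

(** * From convergence near an end point back to vanishing tails *)

(** Each of the finitely many remaining functions has its own level by boundedness. The maximum of
    all levels works, since [Js n (- c)] decreases as [c] grows. *)
Lemma tails_vanish_eventually (Js : nat -> R -> R) :
    (forall n, idf_like (Js n)) ->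
    (forall n, exists M, forall x, - Js n x <= M) ->
    (forall e, 0 < e -> exists c,
       \forall n \near \oo, forall x, Js n (- c) - Js n x <= e) ->
  tails_vanish Js.
Proof.
move=> idfJs bJs h e e0; have [c [N _ hN]] := h e e0.
have /choice[g hg] n : exists c, forall x, Js n (- c) - Js n x <= e.
  have [c' _ hc'] := tails_vanish_cst (idfJs n) (bJs n) e0.
  by exists c'; exact: hc' 0%N.
pose C := \big[Num.max/Num.max c 0]_(i < N) g i.
have cC : Num.max c 0 <= C by exact: bigmax_ge_id.
exists C => [|n x]; first by rewrite (le_trans _ cC)// le_max lexx orbT.
have mono c' : c' <= C -> Js n (- C) <= Js n (- c').
  move=> c'C; have [_ Jlip _ _ _] := idfJs n.
  by have := Jlip (- C) (- c'); rewrite lerN2 => /(_ c'C); lra.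
have [Nn|nN] := leqP N n.
  have := hN n Nn x; have : c <= C by rewrite (le_trans _ cC)// le_max lexx.
  by move/mono; lra.
have : g n <= C by exact: (le_bigmax _ (fun i : 'I_N => g i) (Ordinal nN)).
by move/mono; have := hg n x; lra.
Qed.

Lemma boundary_cvg_tails_vanish (Js : nat -> R -> R) J (f : R -> R) :
    (forall n, idf_like (Js n)) -> idf_like J ->
    (forall x, Js n x @[n --> \oo] --> J x) ->
    (forall n, exists M, forall x, - Js n x <= M) ->
    conjugate (Js n) 0 @[n --> \oo] --> (f 0)%:E ->
    (forall e, 0 < e -> exists2 dl, 0 < dl & forall u, 0 < u -> u < dl ->
       conjugate (Js n) u @[n --> \oo] --> (f u)%:E /\ f 0 - e <= f u) ->
  tails_vanish Js.
Proof.
move=> idfJs idfJ cvgJ bJs cvg0 hf; apply: tails_vanish_eventually => // e' e'0.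
pose e := e' / 5; have e0 : 0 < e by rewrite divr_gt0.
have [_ _ _ Jy _] := idfJ; have [|c hc] := Jy (1 / 2); first lra.
have [dl dl0 hdl] := hf e e0.
(* Small enough for the hypothesis on [f], at most the slope [1 / 2] that [J] has beyond [c], and
   with [|c| * u] at most [e]. *)
pose u := Num.min (dl / 2) (Num.min (1 / 2) (e / (`|c| + 1))).
have c1 : 0 < `|c| + 1 by rewrite ltr_pwDr.
have u0 : 0 < u by rewrite !lt_min !divr_gt0.
have udl : u < dl.
  have : u <= dl / 2 by rewrite ge_min lexx.
  lra.
have u2 : u <= 1 / 2 by rewrite !ge_min lexx orbT.
have cu : `|c| * u <= e.
  have : u <= e / (`|c| + 1) by rewrite !ge_min lexx !orbT.
  rewrite ler_pdivlMr// mulrC; apply: le_trans.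
  by rewrite ler_wpM2r ?(ltW u0)// lerDl.
have u1 : u < 1 by lra.
have [cvgu fu] := hdl u u0 udl.
have [fin_u cvgu'] := conjugate_cvg_interior idfJs idfJ cvgJ u0 u1.
have fuE : conjugate J u = (f u)%:E.
  by rewrite -(fineK fin_u); apply: cvg_unique cvgu' cvgu.
have [x hx] : exists x, f 0 - 2 * e < x * u - J x.
  apply: contrapT => /forallNP h.
  have : (conjugate J u <= (f 0 - 2 * e)%:E)%E.
    by apply: conjugate_le => x; rewrite lee_fin leNgt; exact/negP.
  rewrite fuE lee_fin; lra.
have [x' hx'] : exists x', f 0 - 3 * e < - J x'.
  have [xc|cx] := leP x c.
    exists x; have : x * u <= e.
      rewrite (le_trans _ cu)// ler_wpM2r ?(ltW u0)//.
      by rewrite (le_trans xc)// ler_norm.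
    lra.
  exists c; have := hc x (ltW cx).
  have : x * u - c * u <= 1 / 2 * (x - c).
    by rewrite -mulrBl mulrC ler_wpM2r// subr_ge0 ltW.
  have : c * u <= e.
    by rewrite (le_trans _ cu)// ler_wpM2r ?(ltW u0)// ler_norm.
  lra.
(* For large [n], [Js n x'] is below [- f 0 + 4 * e] and [- Js n y] is at most [f 0 + e], which
   together give [5 * e]. *)
exists (- x').
have /fine_cvgP[fin0 /cvgrPdist_le/(_ e e0) near0] := cvg0.
near=> n => y; rewrite opprK.
have : `|J x' - Js n x'| <= e by near: n; exact: (near_close cvgJ).
have : `|f 0 - fine (conjugate (Js n) 0)| <= e by near: n.
have finn : conjugate (Js n) 0 \is a fin_num by near: n.
have := conjugate_ub (Js n) 0 y; rewrite -(fineK finn) lee_fin mulr0.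
rewrite !ler_norml => ? /andP[? ?] /andP[? ?].
by have : e = e' / 5 by []; lra.
Unshelve. all: by end_near. Qed.

Lemma within_continuous_dist A (f : R -> R) u e :
    {within A, continuous f} -> A u -> 0 < e ->
  exists2 dl, 0 < dl & forall v, A v -> `|v - u| < dl -> `|f v - f u| <= e.
Proof.
move=> /subspace_continuousP cf Au e0.
have /cvgrPdist_le/(_ e e0) := cf u Au.
rewrite near_withinE => /nbhs_ballP[dl /= dl0 h]; exists dl => // v Av vu.
by rewrite distrC; apply: h => //; rewrite /ball/= distrC.
Qed.

End convex_conjugate.

(** For convexity both slopes are compared with [F y]. For the last two clauses [c] is taken so far
    out that [F c] is at least, respectively at most, [b]. *)
Lemma idf_like_integrated_cdf (R : realType) (d : measure_display)
    (T : measurableType d) (P : probability T R) (X : {RV P >-> R}) :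
  idf_like (integrated_cdf X).
Proof.
set F := fun t => fine (cdf X t).
have slope x y : x <= y ->
    F x * (y - x) <= integrated_cdf X y - integrated_cdf X x <= F y * (y - x)
    := @integrated_cdf_slope _ _ _ _ X x y.
split.
- exact: integrated_cdf0.
- move=> x y xy; have /andP[ge le] := slope x y xy; apply/andP; split.
    by apply: le_trans ge; rewrite mulr_ge0 ?fine_cdf_ge0// subr_ge0.
  by apply: le_trans le _; rewrite ler_piMl ?fine_cdf_le1// subr_ge0.
- move=> x y z xy yz; have /andP[_ le] := slope x y xy.
  have /andP[ge _] := slope y z yz.
  apply: (@le_trans _ _ (F y * (y - x) * (z - y))).
    by rewrite ler_wpM2r// subr_ge0.
  by rewrite mulrAC ler_wpM2r// subr_ge0.
- move=> b b1; have /fine_cvgP[_ /cvgrPdist_le/(_ (1 - b))] := cvg_cdfy1 X.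
  rewrite subr_gt0 => /(_ b1) F1.
  near (+oo : set_system R) => c; exists c => x cx.
  have /andP[ge _] := slope c x cx; apply: le_trans ge.
  have : `|1 - F c| <= 1 - b by near: c.
  rewrite ler_norml => /andP[_ ?]; rewrite ler_wpM2r ?subr_ge0//; lra.
- move=> b b0; have /fine_cvgP[_ /cvgrPdist_le/(_ b b0) F0] := cvg_cdfNy0 X.
  near (-oo : set_system R) => c; exists c => x xc.
  have /andP[_ le] := slope x c xc; apply: le_trans le _.
  have : `|0 - F c| <= b by near: c.
  rewrite ler_norml => /andP[? _]; rewrite ler_wpM2r ?subr_ge0//; lra.
Unshelve. all: by end_near. Qed.

Lemma all_equiv3 (A B C : Prop) :
  (A -> C) -> (C -> B) -> (B -> A) -> [<-> A; B; C].
Proof. by move=> AC CB BA; tfae; tauto. Qed.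

(** * The equivalences *)

Section equivalences.
Context (R : realType) (Js : nat -> R -> R) (J : R -> R)
  (idfJs : forall n, idf_like (Js n)) (idfJ : idf_like J)
  (cvgJ : forall x, Js n x @[n --> \oo] --> J x).
Let K n := conjugate (Js n).

(** This and the next three facts make each single conjugate continuous: at an end point of the
    interval boundedness is used, away from it the slopes suffice. *)
Let bounded_left_tight (A : set R) n : A `<=` [set u | 0 <= u] ->
  (exists M, forall x, - Js n x <= M) -> left_tight (fun=> Js n) A.
Proof.
by move=> A0 bJ; apply: tails_vanish_left_tight => //; exact: tails_vanish_cst.
Qed.

Let bounded_right_tight (A : set R) n : A `<=` [set u | u <= 1] ->
  (exists M, forall x, - reflected (Js n) x <= M) -> right_tight (fun=> Js n) A.
Proof.
move=> A1 bJ; apply: tails_vanish_right_tight => //.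
by apply: tails_vanish_cst => //; exact: idf_like_reflected.
Qed.

Let interior_right_tight (A : set R) n (b : R) :
  b < 1 -> A `<=` [set u | u <= b] -> right_tight (fun=> Js n) A.
Proof.
move=> b1 Ab; apply: (@right_tight_cvg _ (fun=> Js n) (Js n) _ _ _ _ b) => // x.
exact: cvg_cst.
Qed.

Let interior_left_tight (A : set R) n (b : R) :
  0 < b -> A `<=` [set u | b <= u] -> left_tight (fun=> Js n) A.
Proof.
move=> b0 Ab; apply: (@left_tight_cvg _ (fun=> Js n) (Js n) _ b) => // x.
exact: cvg_cst.
Qed.

Lemma cvg_left_end A (f : R -> R) :
    (forall n, exists M, forall x, - Js n x <= M) ->
    A 0 -> (forall u, 0 < u -> u < 1 -> A u) -> {within A, continuous f} ->
    (forall u, A u -> K n u @[n --> \oo] --> (f u)%:E) ->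
  tails_vanish Js.
Proof.
move=> bJ A0 A01 cf Kf.
apply: (boundary_cvg_tails_vanish idfJs idfJ cvgJ bJ (Kf 0 A0)).
move=> e e0; have [dl dl0 hdl] := within_continuous_dist cf A0 e0.
(* The bound 1 keeps [u] inside the open unit interval, hence in [A]. *)
exists (Num.min dl 1) => [|u u0]; first by rewrite lt_min dl0 ltr01.
rewrite lt_min => /andP[udl u1]; have Au := A01 u u0 u1; split; first exact: Kf.
have := hdl u Au; rewrite subr0 gtr0_norm// => /(_ udl).
by rewrite ler_norml; lra.
Qed.

Lemma cvg_right_end A (f : R -> R) :
    (forall n, exists M, forall x, - reflected (Js n) x <= M) ->
    A 1 -> (forall u, 0 < u -> u < 1 -> A u) -> {within A, continuous f} ->
    (forall u, A u -> K n u @[n --> \oo] --> (f u)%:E) ->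
  tails_vanish (fun n => reflected (Js n)).
Proof.
move=> bJ A1 A01 cf Kf.
have Kr u : A (1 - u) ->
    conjugate (reflected (Js n)) u @[n --> \oo] --> (f (1 - u))%:E.
  by move=> Au; under eq_cvg do rewrite conjugate_reflected; exact: Kf.
apply: (@boundary_cvg_tails_vanish _ _ (reflected J) (fun u => f (1 - u))) => //.
- by move=> n; exact: idf_like_reflected.
- exact: idf_like_reflected.
- by move=> x; apply: cvgD; [exact: cvg_cst|exact: cvgJ].
- by apply: Kr; rewrite subr0.
- move=> e e0; have [dl dl0 hdl] := within_continuous_dist cf A1 e0.
  exists (Num.min dl 1) => [|u u0]; first by rewrite lt_min dl0 ltr01.
  rewrite lt_min => /andP[udl u1].
  have Au : A (1 - u) by apply: A01; lra.
  split; first exact: Kr.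
  have := hdl (1 - u) Au.
  rewrite addrAC subrr sub0r normrN gtr0_norm// => /(_ udl).
  by rewrite subr0 ler_norml; lra.
Qed.

Lemma two_sided_equivalence :
    (forall n, exists M, forall x, - Js n x <= M) ->
    (forall n, exists M, forall x, - reflected (Js n) x <= M) ->
  [<-> tails_vanish Js /\ tails_vanish (fun n => reflected (Js n));
       exists f : R -> R, {within `[0, 1], continuous f} /\
         (forall u : R, `[0, 1]%classic u -> K n u @[n --> \oo] --> (f u)%:E);
       exists f : R -> R, cvg_uniformly_on `[0, 1] K f].
Proof.
move=> bl br; apply: all_equiv3.
- move=> [tl tr]; exists (fun u => fine (conjugate J u)).
  apply: tight_uniform => //.
  apply: tightI.
    by apply: tails_vanish_left_tight => // u; rewrite /= in_itv/= => /andP[].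
  by apply: tails_vanish_right_tight => // u; rewrite /= in_itv/= => /andP[].
- move=> [f Kf]; exists f; split; last first.
    by move=> u Au; exact: cvg_uniformly_on_cvg Kf.
  apply: (@conjugate_limit_continuous _ _ Js) => u Au.
  exists `[0, 1]%classic; split; [by []|by near=> v|exact: Kf|move=> n].
  apply: tightI.
    by apply: bounded_left_tight => // v; rewrite /= in_itv/= => /andP[].
  by apply: bounded_right_tight => // v; rewrite /= in_itv/= => /andP[].
- move=> [f [cf Kf]]; split.
  + apply: cvg_left_end cf Kf => //; first by rewrite /= in_itv/= lexx ler01.
    by move=> u u0 u1; rewrite /= in_itv/= !ltW.
  + apply: cvg_right_end cf Kf => //; first by rewrite /= in_itv/= lexx ler01.
    by move=> u u0 u1; rewrite /= in_itv/= !ltW.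
Unshelve. all: by end_near. Qed.

Lemma left_equivalence :
    (forall n, exists M, forall x, - Js n x <= M) ->
  [<-> tails_vanish Js;
       exists f : R -> R, {within `[0, 1[, continuous f} /\
         (forall u : R, `[0, 1[%classic u -> K n u @[n --> \oo] --> (f u)%:E);
       exists f : R -> R, forall b : R, `[0, b] `<=` `[0, 1[%classic ->
         cvg_uniformly_on `[0, b] K f].
Proof.
move=> bl.
have itv_lt1 (b : R) : 0 <= b -> `[0, b] `<=` `[0, 1[%classic -> b < 1.
  by move=> b0 /(_ b); rewrite /= !in_itv/= b0 lexx; exact.
have sub_itv (b : R) : b < 1 -> `[0, b] `<=` `[0, 1[%classic.
  by move=> b1 u; rewrite /= !in_itv/= => /andP[-> /le_lt_trans]; exact.
(* The midpoint of [u] and 1 bounds a compact interval that is a neighbourhood of [u] relative to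
   [[0, 1[]. *)
have mid (u : R) : 0 <= u -> u < 1 ->
    `[0, (1 + u) / 2]%classic u /\ (1 + u) / 2 < 1.
  by move=> u0 u1; rewrite /= in_itv/=; split; [apply/andP; split|]; lra.
apply: all_equiv3.
- move=> tl; exists (fun u => fine (conjugate J u)) => b b1.
  (* For [b < 0] the interval is empty and the inclusion does not bound it; uniform convergence is
     then vacuous. *)
  have [b0|b0] := ltP b 0.
    move=> e e0; near=> n => u; rewrite /= in_itv/= => /andP[u0 ub].
    by have := le_lt_trans (le_trans u0 ub) b0; rewrite ltxx.
  apply: tight_uniform => //; apply: tightI.
    by apply: tails_vanish_left_tight => // u; rewrite /= in_itv/= => /andP[].
  apply: (right_tight_cvg idfJs idfJ cvgJ (itv_lt1 b b0 b1)) => u.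
  by rewrite /= in_itv/= => /andP[].
- move=> [f Kf]; exists f; split.
    apply: (@conjugate_limit_continuous _ _ Js) => u.
    rewrite /= in_itv/= => /andP[u0 u1].
    have [umid mid1] := mid u u0 u1.
    exists `[0, (1 + u) / 2]%classic; split => //.
    + have : u < (1 + u) / 2 by lra.
      move=> /lt_nbhsl; apply: filterS => v vm.
      by rewrite /= !in_itv/= => /andP[-> _]; exact: ltW.
    + exact/Kf/sub_itv.
    + move=> n; apply: tightI.
        by apply: bounded_left_tight => // v; rewrite /= in_itv/= => /andP[].
      apply: (interior_right_tight _ mid1) => v.
      by rewrite /= in_itv/= => /andP[].
  move=> u; rewrite /= in_itv/= => /andP[u0 u1].
  have [umid mid1] := mid u u0 u1.
  exact: cvg_uniformly_on_cvg umid (Kf _ (sub_itv _ mid1)).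
- move=> [f [cf Kf]]; apply: cvg_left_end cf Kf => //.
    by rewrite /= in_itv/= lexx ltr01.
  by move=> u u0 u1; rewrite /= in_itv/= u1 ltW.
Unshelve. all: by end_near. Qed.

Lemma right_equivalence :
    (forall n, exists M, forall x, - reflected (Js n) x <= M) ->
  [<-> tails_vanish (fun n => reflected (Js n));
       exists f : R -> R, {within `]0, 1], continuous f} /\
         (forall u : R, `]0, 1]%classic u -> K n u @[n --> \oo] --> (f u)%:E);
       exists f : R -> R, forall a : R, `[a, 1] `<=` `]0, 1]%classic ->
         cvg_uniformly_on `[a, 1] K f].
Proof.
move=> br.
have itv_gt0 (a : R) : a <= 1 -> `[a, 1] `<=` `]0, 1]%classic -> 0 < a.
  move=> a1 /(_ a); rewrite /= !in_itv/= a1 lexx => /(_ isT).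
  by rewrite andbT.
have sub_itv (a : R) : 0 < a -> `[a, 1] `<=` `]0, 1]%classic.
  by move=> a0 u; rewrite /= !in_itv/= => /andP[/(lt_le_trans a0) -> ->].
have mid (u : R) : 0 < u -> u <= 1 -> `[u / 2, 1]%classic u /\ 0 < u / 2.
  by move=> u0 u1; rewrite /= in_itv/=; split; [apply/andP; split|]; lra.
apply: all_equiv3.
- move=> tl; exists (fun u => fine (conjugate J u)) => a a0.
  have [a1|a1] := ltP 1 a.
    move=> e e0; near=> n => u; rewrite /= in_itv/= => /andP[au u1].
    by have := lt_le_trans a1 (le_trans au u1); rewrite ltxx.
  apply: tight_uniform => //; apply: tightI; last first.
    by apply: tails_vanish_right_tight => // u; rewrite /= in_itv/= => /andP[].
  apply: (left_tight_cvg idfJs idfJ cvgJ (itv_gt0 a a1 a0)) => u.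
  by rewrite /= in_itv/= => /andP[].
- move=> [f Kf]; exists f; split.
    apply: (@conjugate_limit_continuous _ _ Js) => u.
    rewrite /= in_itv/= => /andP[u0 u1].
    have [umid mid0] := mid u u0 u1.
    exists `[u / 2, 1]%classic; split => //.
    + have : u / 2 < u by lra.
      move=> /lt_nbhsr; apply: filterS => v vm.
      by rewrite /= !in_itv/= => /andP[_ ->]; rewrite andbT ltW.
    + exact/Kf/sub_itv.
    + move=> n; apply: tightI; last first.
        by apply: bounded_right_tight => // v; rewrite /= in_itv/= => /andP[].
      apply: (interior_left_tight _ mid0) => v.
      by rewrite /= in_itv/= => /andP[].
  move=> u; rewrite /= in_itv/= => /andP[u0 u1].
  have [umid mid0] := mid u u0 u1.
  exact: cvg_uniformly_on_cvg umid (Kf _ (sub_itv _ mid0)).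
- move=> [f [cf Kf]]; apply: cvg_right_end cf Kf => //.
    by rewrite /= in_itv/= lexx ltr01.
  by move=> u u0 u1; rewrite /= in_itv/= u0 ltW.
Unshelve. all: by end_near. Qed.

End equivalences.

Theorem theorem10 (R : realType) (d : nat -> measure_display)
    (T : forall n, measurableType (d n)) (P : forall n, probability (T n) R)
    (X : forall n, {RV (P n) >-> R}) (hX : weakly_convergent X) :
  [/\ (forall n, ('E_(P n)[fun w => `|X n w|%R] < +oo)%E) ->
      [<-> uniformly_integrable P (fun n w => `|X n w|);
           exists f : R -> R, {within `[0, 1], continuous f} /\
             (forall u : R, `[0, 1]%classic u ->
               integrated_quantile (X n) u @[n --> \oo] --> (f u)%:E);
           exists f : R -> R,
             cvg_uniformly_on `[0, 1] (fun n => integrated_quantile (X n)) f],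
      (forall n, ('E_(P n)[(X n : T n -> R)^\-%R] < +oo)%E) ->
      [<-> uniformly_integrable P (fun n => (X n : T n -> R)^\-);
           exists f : R -> R, {within `[0, 1[, continuous f} /\
             (forall u : R, `[0, 1[%classic u ->
               integrated_quantile (X n) u @[n --> \oo] --> (f u)%:E);
           exists f : R -> R,
             forall b : R, `[0, b] `<=` `[0, 1[%classic ->
             cvg_uniformly_on `[0, b] (fun n => integrated_quantile (X n)) f]
    & (forall n, ('E_(P n)[(X n : T n -> R)^\+%R] < +oo)%E) ->
      [<-> uniformly_integrable P (fun n => (X n : T n -> R)^\+);
           exists f : R -> R, {within `]0, 1], continuous f} /\
             (forall u : R, `]0, 1]%classic u ->
               integrated_quantile (X n) u @[n --> \oo] --> (f u)%:E);
           exists f : R -> R,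
             forall a : R, `[a, 1] `<=` `]0, 1]%classic ->
             cvg_uniformly_on `[a, 1] (fun n => integrated_quantile (X n)) f]].
Proof.
have [d' [T' [P' [Y XY]]]] := hX.
have cvgJ := integrated_cdf_cvg XY.
have idfX n := idf_like_integrated_cdf (X n).
have idfY := idf_like_integrated_cdf Y.
split=> EX.
(* Uniform integrability of the absolute values becomes the vanishing of both tails, the form taken
   by the abstract equivalence. *)
- rewrite (propext (uniformly_integrable_norm X)).
  rewrite (propext (uniformly_integrable_funrneg X)).
  rewrite (propext (uniformly_integrable_funrpos X)).
  apply: (two_sided_equivalence idfX idfY cvgJ) => n.
    exact/integrated_cdf_bounded/expectation_funrneg_lty.
  exact/reflected_integrated_cdf_bounded/expectation_funrpos_lty.
- rewrite (propext (uniformly_integrable_funrneg X)).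
  apply: (left_equivalence idfX idfY cvgJ) => n.
  exact: integrated_cdf_bounded.
- rewrite (propext (uniformly_integrable_funrpos X)).
  apply: (right_equivalence idfX idfY cvgJ) => n.
  exact: reflected_integrated_cdf_bounded.
Qed.
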